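(* Let $\bm L=(L_1,\dots,L_r)$ be linear functionals on complex Laurent polynomials with $L_j[w^k]=L_j[w^{-k}]$ for all $k\in\mathbb N$, let $M_j[x^k]=L_j[(w+w^{-1})^k]$ define functionals $M_j$ on polynomials, and suppose $(\bm n;\bm n)$ and $(\bm n+\bm e_j;\bm n)$ are normal for $\bm L$ for all $\bm n\in\mathbb N^r$ and all $j$ (so that $\bm M=(M_1,\dots,M_r)$ is perfect). Let $a_{\bm n,j},b_{\bm n,j}$ be the nearest neighbour recurrence coefficients of $\bm M$. Then for every $\bm n\in\mathbb N^r$ and $j$ with $n_j\ge1$, $$a_{\bm n,j}=\frac{(1+\alpha_{\bm n-\bm e_j;\bm n-\bm e_j})(1-\alpha_{\bm n-\bm e_j;\bm n}^2)\rho_{\bm n;\bm n,j}}{1+\alpha_{\bm n;\bm n}},$$ $$b_{\bm n,j}=\sum_{\ell\ne j}\rho_{\bm n;\bm n,\ell}\gamma^{\ell j}_{\bm n;\bm n}+\alpha_{\bm n;\bm n-\bm e_j}-\alpha_{\bm n+\bm e_j;\bm n}-\alpha_{\bm n;\bm n}\alpha_{\bm n-\bm e_j;\bm n}-\alpha_{\bm n;\bm n}\alpha_{\bm n+\bm e_j;\bm n}.$$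
   Context: Fix $r\ge1$; $\mathbb N=\{0,1,2,\dots\}$; $\bm e_j$ the $j$-th standard unit vector; for $\bm v\in\mathbb Z^r$, $|\bm v|=v_1+\dots+v_r$ (signed). Let $c_{k,j}=L_j[w^{-k}]$. $\mathfrak C_{2r}=\{(\bm n;\bm m)\in\mathbb Z^r\times\mathbb Z^r:n_j+m_j\ge0\ \forall j\}$. For $(\bm n;\bm m)\in\mathfrak C_{2r}$, $\bm n\ne-\bm m$, $T_{\bm n;\bm m}$ is the square matrix of size $|\bm n|+|\bm m|$ with rows indexed by $(j,k)$, $1\le j\le r$, $-m_j\le k\le n_j-1$ (ordered by $j$, then increasing $k$), columns indexed by $i=-|\bm m|,\dots,|\bm n|-1$, entries $c_{k-i,j}$; $T_{\bm n;-\bm n}:=1$; normal means $\det T_{\bm n;\bm m}\ne0$. (Under the symmetry $L_j[w^k]=L_j[w^{-k}]$, $(\bm n;\bm m)$ is normal iff $(\bm m;\bm n)$ is.) For normal $(\bm n;\bm m)$, $\bm n\ne-\bm m$: $\Phi_{\bm n;\bm m}$ is the unique Laurent polynomial in $\operatorname{span}\{z^k\}_{k=-|\bm m|}^{|\bm n|}$ with $z^{|\bm n|}$-coefficient $1$ and $L_j[\Phi_{\bm n;\bm m}(w)w^{-k}]=0$ for $-m_j\le k\le n_j-1$, all $j$; $\Phi_{\bm n;-\bm n}=1$; $\alpha_{\bm n;\bm m}$ := $z^{-|\bm m|}$-coefficient of $\Phi_{\bm n;\bm m}$. $\rho_{\bm n;\bm m,\ell}=L_\ell[\Phi_{\bm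 n;\bm m}(w)w^{-n_\ell}]/L_\ell[\Phi_{\bm n-\bm e_\ell;\bm m}(w)w^{-n_\ell+1}]$ if $(\bm n-\bm e_\ell;\bm m)\in\mathfrak C_{2r}$, and $\rho_{\bm n;\bm m,\ell}=0$ otherwise. For $\ell\ne j$: $\gamma^{\ell j}_{\bm n;\bm m}=L_j[\Phi_{\bm n+\bm e_\ell;\bm m}(w)w^{-n_j}]/L_j[\Phi_{\bm n;\bm m}(w)w^{-n_j}]$, i.e. the number with $\Phi_{\bm n+\bm e_\ell;\bm m}-\Phi_{\bm n+\bm e_j;\bm m}=\gamma^{\ell j}_{\bm n;\bm m}\Phi_{\bm n;\bm m}$. For $\bm n\in\mathbb N^r$, $P_{\bm n}$ denotes the unique monic polynomial of degree $|\bm n|$ with $M_j[P_{\bm n}(x)x^k]=0$ for $0\le k\le n_j-1$, all $j$ (put $P_{\bm n-\bm e_j}:=0$ if $n_j=0$). The nearest neighbour recurrence coefficients are the complex numbers $a_{\bm n,j},b_{\bm n,k}$ such that $xP_{\bm n}(x)=P_{\bm n+\bm e_k}(x)+b_{\bm n,k}P_{\bm n}(x)+\sum_{j=1}^ra_{\bm n,j}P_{\bm n-\bm e_j}(x)$ for all $\bm n\in\mathbb N^r$ and $k=1,\dots,r$. *)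

(* Defs.v *)
From mathcomp Require Import all_boot all_order all_algebra.
From mathcomp Require Export reals.
From mathcomp.real_closed Require Export complex.
Set Implicit Arguments. Unset Strict Implicit. Unset Printing Implicit Defensive.
Import Order.TTheory GRing.Theory Num.Theory.
Local Open Scope ring_scope.

Section Defs.
Variable F : fieldType.
Variable r : nat.

Definition mind := {ffun 'I_r -> int}.
Definition unitv (j : 'I_r) : mind := [ffun i => ((i == j)%N : nat)%:Z].
Definition msum (v : mind) : int := \sum_(i < r) v i.
Definition mnat (v : mind) : bool := [forall i, 0 <= v i].
Definition inC (n m : mind) : bool := [forall j, 0 <= n j + m j].

(* Complex Laurent polynomials: (lo, p) stands for  z^lo * p(z). *)
Definition lpoly := (int * {poly F})%type.
Definition lpcoef (f : lpoly) (k : int) : F :=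
  if f.1 <= k then (f.2)`_(absz (k - f.1)) else 0.
Definition lshift (f : lpoly) (p : int) : lpoly := (f.1 + p, f.2).
(* A linear functional L on Laurent polynomials is given by its moments
   mu k = L[w^k]; lapply mu f = L[f]. *)
Definition lapply (mu : int -> F) (f : lpoly) : F :=
  \sum_(i < size f.2) (f.2)`_i * mu (f.1 + i%:Z).

(* The functionals L_j : Lm j k = L_j[w^k]. *)
Variable Lm : 'I_r -> int -> F.

Definition cmom (k : int) (j : 'I_r) : F := Lm j (- k).

Definition irange (lo hi : int) : seq int :=
  [seq lo + i%:Z | i <- iota 0 (absz (hi - lo))].

Definition Trows (n m : mind) : seq ('I_r * int) :=
  flatten [seq [seq (j, k) | k <- irange (- m j) (n j)] | j <- enum 'I_r].

Definition Tsize (n m : mind) : nat := absz (msum n + msum m).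

Definition Tmat (n m : mind) : 'M[F]_(Tsize n m) :=
  \matrix_(a < Tsize n m, b < Tsize n m)
    match onth (Trows n m) a with
    | Some (j, k) => cmom (k - (- msum m + b%:Z)) j
    | None => 0
    end.

Definition normal (n m : mind) : bool :=
  inC n m && ((n == - m) || (\det (Tmat n m) != 0)).

Definition IsPhi (n m : mind) (f : lpoly) : Prop :=
  if n == - m then (forall k : int, lpcoef f k = (k == 0)%:R)
  else
    (forall k : int, (k < - msum m) || (msum n < k) -> lpcoef f k = 0) /\
    lpcoef f (msum n) = 1 /\
    (forall j (k : int), - m j <= k <= n j - 1 -> lapply (Lm j) (lshift f (- k)) = 0).

Variable Phi : mind -> mind -> lpoly.

Definition alpha (n m : mind) : F := lpcoef (Phi n m) (- msum m).

Definition rho (n m : mind) (l : 'I_r) : F :=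
  if inC (n - unitv l) m then
    lapply (Lm l) (lshift (Phi n m) (- n l)) /
    lapply (Lm l) (lshift (Phi (n - unitv l) m) (- n l + 1))
  else 0.

Definition gamma (n m : mind) (l j : 'I_r) : F :=
  lapply (Lm j) (lshift (Phi (n + unitv l) m) (- n j)) /
  lapply (Lm j) (lshift (Phi n m) (- n j)).

(* M_j[x^k] = L_j[(w + w^{-1})^k] = L_j[w^{-k} (1 + w^2)^k] *)
Definition Mmom (j : 'I_r) (k : nat) : F :=
  lapply (Lm j) (- (k%:Z), ('X^2 + 1) ^+ k).
Definition Mapply (j : 'I_r) (p : {poly F}) : F :=
  \sum_(k < size p) p`_k * Mmom j k.

Definition IsP (n : mind) (p : {poly F}) : Prop :=
  p \is monic /\ size p = (absz (msum n) + 1)%N /\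
  (forall j (k : nat), k%:Z < n j -> Mapply j (p * 'X^k) = 0).

End Defs.

(* Main.v *)
Require Import Defs.
From mathcomp Require Import all_boot all_order all_algebra.
From mathcomp Require Import reals.
From mathcomp.real_closed Require Import complex.
From mathcomp Require Import zify ring.
Import Order.TTheory GRing.Theory Num.Theory.
Local Open Scope ring_scope.

(* Write f*(z) = f(1/z), A = Phi_{n;n}, B_j = Phi_{n+e_j;n}, C_l = Phi_{n-e_l;n},
   X_j = Phi_{n;n+e_j}, and p_n(z) = P_n(z + 1/z).  Symmetry of the L_j sends
   orthogonality at w^k to orthogonality of f* at w^-k, so A + A* and B_j + B_j*
   satisfy the orthogonality relations of p_n and p_{n+e_j}; hence
     A + A* = (1 + alpha_{n;n}) p_n   and   B_j + B_j* = p_{n+e_j}.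
   Evaluating the first at the critical exponent and using the recurrence gives
   a_{n,j} as a ratio of edge values L_j[A w^-n_j], and
     X_j = A + alpha_{n;n+e_j} z^-1 A*
   compares the edge values of X_j and A, producing the factor 1 - alpha^2.
   b_{n,j} is the difference of the second coefficients of P_n = (B_j + B_j* at
   n - e_j) and P_{n+e_j}; these are computed from
     Phi_{n+e_j;n+e_j} = B_j + alpha_{n+e_j;n+e_j} z^-1 X_j*,
     z A = B_j - alpha_{n+e_j;n} A* + sum_{l <> j} rho_l gamma^{lj} z C_l.
   Each identity holds because the difference of its sides is annihilated by a
   normal (invertible) moment matrix. *)

(** * Laurent polynomials as coefficient functions, and their moments over a symmetric window *)

Section LaurentCoefficients.
Set Implicit Arguments.
Unset Strict Implicit.

Variable F : fieldType.
Implicit Types (f g mu : int -> F) (K : nat) (lo hi i k s : int).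

(* Laurent polynomials are coefficient functions int -> F, and ev K mu f k is
   L[f(w) w^-k] as soon as f is supported in [-K, K]. *)
Definition supp (lo hi : int) f := forall k : int, (k < lo) || (hi < k) -> f k = 0.

Definition ev K mu f (k : int) : F :=
  \sum_(i < K.*2.+1) f (- K%:Z + i%:Z) * mu (- K%:Z + i%:Z - k).

Lemma supp_widen lo hi lo' hi' f : lo' <= lo -> hi <= hi' ->
  supp lo hi f -> supp lo' hi' f.
Proof. by move=> h1 h2 hf k hk; apply: hf; lia. Qed.

Lemma window_incl g lo lo' (len len' : nat) :
  (forall k : int, (k < lo) || (lo + len%:Z <= k) -> g k = 0) ->
  lo' <= lo -> lo + len%:Z <= lo' + len'%:Z ->
  \sum_(i < len') g (lo' + i%:Z) = \sum_(i < len) g (lo + i%:Z).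
Proof.
move=> g0 h1 h2.
have [d hd] : exists d : nat, lo = lo' + d%:Z by exists `|lo - lo'|%N; lia.
have [e he] : exists e : nat, len' = (d + len + e)%N.
  by exists (len' - (d + len))%N; lia.
subst lo len'; rewrite big_split_ord big_split_ord /=.
rewrite [X in X + _ + _]big1 ?add0r; last first.
  by move=> i _; apply: g0; have := ltn_ord i; lia.
rewrite [X in _ + X]big1 ?addr0; last by move=> i _; apply: g0; lia.
by apply: eq_bigr => i _; congr g; lia.
Qed.

(** Neither window need contain the other, so both are compared with one symmetric window covering
    them. *)
Lemma window_eq g lo lo' (len len' : nat) :
  (forall k : int, (k < lo) || (lo + len%:Z <= k) -> g k = 0) ->
  (forall k : int, (k < lo') || (lo' + len'%:Z <= k) -> g k = 0) ->
  \sum_(i < len') g (lo' + i%:Z) = \sum_(i < len) g (lo + i%:Z).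
Proof.
move=> g0 g0'; pose K := (`|lo| + `|lo'| + len + len')%N.
rewrite -(@window_incl g lo (- K%:Z) len K.*2.+1) //; try lia.
by rewrite -(@window_incl g lo' (- K%:Z) len' K.*2.+1) //; lia.
Qed.

Lemma ev_eq K mu f g k : f =1 g -> ev K mu f k = ev K mu g k.
Proof. by move=> fg; apply: eq_bigr => i _; rewrite fg. Qed.

Lemma ev_eq0 K mu f k : f =1 (fun=> 0) -> ev K mu f k = 0.
Proof. by move=> f0; apply: big1 => i _; rewrite f0 mul0r. Qed.

Lemma evD K mu f g k :
  ev K mu (fun i => f i + g i) k = ev K mu f k + ev K mu g k.
Proof. by rewrite -big_split; apply: eq_bigr => i _; rewrite /= mulrDl. Qed.

Lemma evZ K mu c f k : ev K mu (fun i => c * f i) k = c * ev K mu f k.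
Proof. by rewrite mulr_sumr; apply: eq_bigr => i _; rewrite mulrA. Qed.

Lemma evB K mu f g k :
  ev K mu (fun i => f i - g i) k = ev K mu f k - ev K mu g k.
Proof.
rewrite -mulN1r -evZ -evD; apply: ev_eq => i.
by rewrite mulN1r.
Qed.

Lemma ev_sum K mu (I : finType) (Pr : pred I) (h : I -> int -> F) k :
  ev K mu (fun i => \sum_(l | Pr l) h l i) k = \sum_(l | Pr l) ev K mu (h l) k.
Proof.
rewrite exchange_big; apply: eq_bigr => i _.
by rewrite mulr_suml.
Qed.

(** The summation window stays fixed, so both [f] and its translate must fit in it for no term to be
    lost. *)
Lemma ev_shift K mu f s k : supp (- K%:Z) K%:Z f ->
  supp (- K%:Z) K%:Z (fun i => f (i + s)) ->
  ev K mu (fun i => f (i + s)) k = ev K mu f (k + s).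
Proof.
move=> h1 h2.
pose g i := f i * mu (i - (k + s)).
transitivity (\sum_(i < K.*2.+1) g (- K%:Z + s + i%:Z)).
  by apply: eq_bigr => i _; rewrite /g; congr (f _ * mu _); lia.
apply: window_eq => i hi; rewrite /g.
  by rewrite h1 ?mul0r //; lia.
by have := h2 (i - s); rewrite subrK => -> ; rewrite ?mul0r //; lia.
Qed.

Lemma ev_rev K mu f k : (forall i, mu (- i) = mu i) ->
  ev K mu (fun i => f (- i)) k = ev K mu f (- k).
Proof.
move=> sym; rewrite /ev (reindex_inj rev_ord_inj) /=.
apply: eq_bigr => i _; have := ltn_ord i => hi.
rewrite -[in LHS]sym; congr (f _ * mu _); lia.
Qed.

(** This is $f \mapsto z^{-1} f(1/z)$. On exponents, $k \mapsto -(k+1)$ exchanges the ranges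
    $[-m_j, n_j-1]$ and $[-n_j, m_j-1]$. *)
Lemma ev_revS K mu f k : (forall i, mu (- i) = mu i) ->
  supp (- K%:Z + 1) (K%:Z - 1) f ->
  ev K mu (fun i => f (- (i + 1))) k = ev K mu f (- (k + 1)).
Proof.
move=> sym hf.
rewrite (@ev_shift K mu (fun i => f (- i)) 1) ?ev_rev // => i hi; apply: hf; lia.
Qed.

Lemma lapply_ev K mu (f : lpoly F) k : supp (- K%:Z) K%:Z (lpcoef f) ->
  lapply mu (Defs.lshift f (- k)) = ev K mu (lpcoef f) k.
Proof.
move=> hf; pose g i := lpcoef f i * mu (i - k).
transitivity (\sum_(i < size f.2) g (f.1 + i%:Z)).
  apply: eq_bigr => i _; rewrite /g /lpcoef /=.
  have -> : f.1 <= f.1 + i%:Z by lia.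
  by congr (_`_ _ * mu _); lia.
apply: window_eq => i hi; rewrite /g.
  by rewrite hf ?mul0r //; lia.
rewrite /lpcoef; case: ifP => h; rewrite ?mul0r // nth_default ?mul0r //.
case: f hi h {hf g} => lo p /=.
lia.
Qed.

End LaurentCoefficients.

(** * Normality as uniqueness for the orthogonality conditions *)

Section Normality.
Set Implicit Arguments.
Unset Strict Implicit.

Variables (F : fieldType) (r : nat) (Lm : 'I_r -> int -> F).
Implicit Types (n m : mind r) (f : int -> F) (K : nat) (i j l : 'I_r) (k : int).

Lemma mindD n m i : (n + m) i = n i + m i. Proof. by rewrite ffunE. Qed.

Lemma mindN n i : (- n) i = - n i. Proof. by rewrite ffunE. Qed.

Lemma unitvE j i : unitv j i = (i == j)%:R :> int.
Proof. by rewrite ffunE; case: eqP. Qed.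

Lemma msumD n m : msum (n + m) = msum n + msum m.
Proof. by rewrite /msum -big_split; apply: eq_bigr => i _; rewrite mindD. Qed.

Lemma msumN n : msum (- n) = - msum n.
Proof. by rewrite /msum -sumrN; apply: eq_bigr => i _; rewrite mindN. Qed.

Lemma msum_unitv j : msum (unitv j) = 1.
Proof.
rewrite /msum (bigD1 j) //= unitvE eqxx big1 ?addr0 // => i /negPf ij.
by rewrite unitvE ij.
Qed.

Lemma mnatP n : reflect (forall i, 0 <= n i) (mnat n).
Proof. exact: forallP. Qed.

Lemma msum_ge0 n : mnat n -> 0 <= msum n.
Proof. by move=> /mnatP hn; apply: sumr_ge0 => i _. Qed.

Lemma msum_ge n j : mnat n -> n j <= msum n.
Proof.
move=> /mnatP hn; rewrite /msum (bigD1 j) //= lerDl.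
by apply: sumr_ge0 => i _.
Qed.

Lemma mnat_addu n j : mnat n -> mnat (n + unitv j).
Proof.
by move=> /mnatP hn; apply/mnatP => i; rewrite mindD unitvE addr_ge0 ?ler0n.
Qed.

Lemma mnat_subu n j : mnat n -> 1 <= n j -> mnat (n - unitv j).
Proof.
move=> /mnatP hn nj; apply/mnatP => i; rewrite mindD mindN unitvE.
by case: eqP => [->|_]; have := hn i; lia.
Qed.

Definition orth K n m f :=
  forall j k, - m j <= k <= n j - 1 -> ev K (Lm j) f k = 0.

Lemma irange_mem (lo hi k : int) : lo <= hi -> (k \in irange lo hi) = (lo <= k < hi).
Proof.
move=> h; apply/mapP/idP => [[a]|hk]; first by rewrite mem_iota; lia.
by exists `|k - lo|%N; rewrite ?mem_iota; lia.
Qed.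

Lemma Trows_mem n m j k : inC n m ->
  ((j, k) \in Trows n m) = (- m j <= k < n j).
Proof.
move=> /forallP hC; have h i : - m i <= n i by have := hC i; lia.
apply/flattenP/idP => [[s /mapP[i _ ->] /mapP[k' hk' [-> ->]]]|hk].
  by rewrite -irange_mem.
exists [seq (j, k) | k <- irange (- m j) (n j)].
  by apply/mapP; exists j; rewrite ?mem_enum.
by apply/mapP; exists k; rewrite ?irange_mem.
Qed.

Lemma size_Trows n m : inC n m -> size (Trows n m) = Tsize n m.
Proof.
move=> /forallP hC; rewrite /Trows size_flatten /shape -map_comp sumnE big_map.
apply/eqP; rewrite -eqz_nat; apply/eqP.
rewrite big_enum /= /Tsize -msumD.
have hs : 0 <= msum (n + m) by apply: msum_ge0; apply/mnatP => i; rewrite mindD.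
transitivity (msum (n + m)); last by lia.
rewrite /msum (big_morph Posz PoszD (erefl _)); apply: eq_bigr => i _ /=.
by rewrite !size_map size_iota mindD; have := hC i; lia.
Qed.

Lemma ev_window K n m mu f k : inC n m ->
  supp (- msum m) (msum n - 1) f -> msum m <= K%:Z -> msum n <= K%:Z + 1 ->
  ev K mu f k =
  \sum_(b < Tsize n m) f (- msum m + b%:Z) * mu (- msum m + b%:Z - k).
Proof.
move=> /forallP hC hf h1 h2.
have hs : 0 <= msum (n + m) by apply: msum_ge0; apply/mnatP => i; rewrite mindD.
rewrite msumD in hs.
pose g (s : int) := f s * mu (s - k).
apply: (@window_incl _ g) => [s hs'||]; rewrite /Tsize; try lia.
by rewrite /g hf ?mul0r //; rewrite /Tsize in hs'; lia.
Qed.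

(** The coefficients of [f] form a row vector killed by the transpose of [Tmat n m], which is
    invertible. *)
Lemma normal_uniq K n m f : normal Lm n m ->
  msum m <= K%:Z -> msum n <= K%:Z + 1 ->
  supp (- msum m) (msum n - 1) f -> orth K n m f -> f =1 (fun=> 0).
Proof.
move=> /andP[hC hN] h1 h2 hf ho.
have hs : 0 <= msum (n + m).
  by apply: msum_ge0; apply/mnatP => i; rewrite mindD; apply: (forallP hC).
rewrite msumD in hs.
have f0 b : (b < Tsize n m)%N -> f (- msum m + b%:Z) = 0.
  (* When [n = - m] the matrix has size 0, so no index [b] exists. *)
  move=> hb; case/orP: hN => [/eqP nm|dN].
    by move: hb; rewrite /Tsize nm msumN; lia.
  pose v := (\row_(b < Tsize n m) f (- msum m + b%:Z)).
  suff : v == 0 by move=> /eqP/rowP/(_ (Ordinal hb)); rewrite !mxE.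
  apply: contraNT dN => v0; rewrite -det_tr; apply/det0P; exists v => //.
  apply/rowP => a; rewrite !mxE.
  case E : (onth (Trows n m) a) => [[j k]|]; last first.
    by apply: big1 => b' _; rewrite !mxE E mulr0.
  rewrite -[RHS](ho j k); last first.
    have := Trows_mem j k hC; suff -> : (j, k) \in Trows n m by lia.
    by apply/onthP; exists a.
  rewrite (ev_window _ _ hC) //; apply: eq_bigr => b' _; rewrite !mxE E /cmom.
  by congr (_ * Lm j _); lia.
move=> k /=; case: (boolP ((k < - msum m) || (msum n - 1 < k))) => [/hf //|hk].
have -> : k = - msum m + absz (k + msum m) by lia.
by apply: f0; rewrite /Tsize; lia.
Qed.

(** Converse of [normal_uniq]: a nonzero kernel vector, padded by zeros, would be a Laurent
    polynomial contradicting uniqueness. *)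
Lemma uniq_normal n m : inC n m ->
  (forall K f, msum m <= K%:Z -> msum n <= K%:Z + 1 ->
    supp (- msum m) (msum n - 1) f -> orth K n m f -> f =1 (fun=> 0)) ->
  normal Lm n m.
Proof.
move=> hC hU; rewrite /normal hC /=; apply/orP; right.
have hs : 0 <= msum (n + m).
  by apply: msum_ge0; apply/mnatP => i; rewrite mindD; apply: (forallP hC).
rewrite msumD in hs.
apply/negP; rewrite -det_tr => /det0P[v /eqP v0 hv]; apply: v0.
(* The inner test is needed because [absz] can also send exponents below [- msum m] into the index
   range. *)
pose f (k : int) := if insub (absz (k + msum m)) is Some b
  then (if - msum m <= k then v 0 b else 0) else 0.
have fE (b : 'I_(Tsize n m)) : f (- msum m + b%:Z) = v 0 b.
  rewrite /f; have -> : absz (- msum m + b%:Z + msum m) = b by lia.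
  by rewrite valK ifT //; lia.
have hf : supp (- msum m) (msum n - 1) f.
  move=> k hk; rewrite /f; case: insubP => // b hb eb; case: ifP => // h.
  by move: hb; rewrite /Tsize; lia.
apply/rowP => b; rewrite -fE mxE.
apply: (hU (absz (msum m) + absz (msum n))%N) => //; try lia.
move=> j k hk.
have : (j, k) \in Trows n m by rewrite Trows_mem //; lia.
move=> /onthP[a ha].
have lta : (a < Tsize n m)%N by rewrite -size_Trows // -onthTE ha.
move: hv => /rowP/(_ (Ordinal lta)); rewrite !mxE => hv.
rewrite (ev_window _ _ hC) // -?[RHS]hv; try lia.
apply: eq_bigr => b' _; rewrite fE !mxE /= ha /cmom.
by congr (_ * Lm j _); lia.
Qed.

Hypothesis Lsym : forall j (k : int), Lm j (- k) = Lm j k.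

(* f |-> z^-1 f(1/z) carries the kernel of T_{m;n} onto that of T_{n;m}. *)
Lemma normal_swap n m : normal Lm n m -> normal Lm m n.
Proof.
move=> hN; have hC : inC m n.
  by apply/forallP => i; rewrite addrC; have /andP[/forallP] := hN.
apply: uniq_normal => // K f h1 h2 hf ho.
have h : (fun s => f (- (s + 1))) =1 (fun=> 0).
  (* The window grows by one since [ev_revS] needs a margin at both ends; [ev_window] then brings
     the value back to [K]. *)
  apply: (@normal_uniq K.+1 n m) => //; try lia.
    by move=> k hk; apply: hf; lia.
  move=> j k hk; rewrite ev_revS //; last by move=> i hi; apply: hf; lia.
  rewrite (@ev_window K.+1 m n) //; try lia.
  by rewrite -(@ev_window K) ?ho //; lia.
by move=> k; have := h (- k - 1); rewrite /= subrK opprK.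
Qed.

End Normality.

(** * The substitution $x = z + z^{-1}$ *)

Section Joukowski.
Set Implicit Arguments.
Unset Strict Implicit.

Variables (F : fieldType).
Implicit Types (Q : {poly F}) (f mu e : int -> F) (K k N : nat).

(* Coefficients of the Laurent polynomials (z + z^-1)^k and Q(z + z^-1). *)
Definition jcoefX k : int -> F := lpcoef (- k%:Z, ('X^2 + 1) ^+ k).

Definition jcoef Q (i : int) : F := \sum_(k < size Q) Q`_k * jcoefX k i.

Lemma jcoefX0 i : jcoefX 0 i = (i == 0)%:R.
Proof.
rewrite /jcoefX /lpcoef /= oppr0 expr0 subr0 coef1.
by case: (ltgtP 0 i) => //= [|<-//]; case: i => -[].
Qed.

Lemma jcoefXS k i : jcoefX k.+1 i = jcoefX k (i - 1) + jcoefX k (i + 1).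
Proof.
rewrite /jcoefX /lpcoef exprS /= mulrDl mul1r coefD coefXnM.
case: ifP => h; last by rewrite !ifF ?addr0 //; lia.
congr (_ + _); last by rewrite ifT; [congr _`_ _; lia | lia].
case: ifP => h2; first by rewrite ifF //; lia.
by rewrite ifT; [congr _`_ _; lia | lia].
Qed.

Lemma jcoefX_supp k : supp (- k%:Z) k%:Z (jcoefX k).
Proof.
elim: k => [|k IH] i hi; first by rewrite jcoefX0 [i == 0]negbTE //; lia.
by rewrite jcoefXS !IH ?addr0 //; lia.
Qed.

Lemma jcoefX_top k : jcoefX k k%:Z = 1.
Proof.
elim: k => [|k IH]; first by rewrite jcoefX0.
rewrite jcoefXS (@jcoefX_supp k (k.+1%:Z + 1)) ?addr0; last by lia.
by rewrite -[RHS]IH; congr jcoefX; lia.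
Qed.

Lemma jcoefX_subtop k : jcoefX k (k%:Z - 1) = 0.
Proof.
elim: k => [|k IH]; first by rewrite jcoefX0.
rewrite jcoefXS (@jcoefX_supp k (_ + 1)) ?addr0; last by lia.
by rewrite -[RHS]IH; congr jcoefX; lia.
Qed.

Lemma jcoefX_even k i : jcoefX k (- i) = jcoefX k i.
Proof.
elim: k i => [|k IH] i; first by rewrite !jcoefX0 oppr_eq0.
rewrite !jcoefXS.
have [-> ->] : - i - 1 = - (i + 1) /\ - i + 1 = - (i - 1) by split; lia.
by rewrite !IH addrC.
Qed.

Lemma jcoef_widen N Q i : (size Q <= N)%N ->
  jcoef Q i = \sum_(k < N) Q`_k * jcoefX k i.
Proof.
move=> hN; rewrite /jcoef (big_ord_widen _ (fun k => Q`_k * jcoefX k i) hN).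
rewrite big_mkcond /=; apply: eq_bigr => k _; case: ltnP => // h.
by rewrite nth_default ?mul0r.
Qed.

Lemma jcoefD Q1 Q2 i : jcoef (Q1 + Q2) i = jcoef Q1 i + jcoef Q2 i.
Proof.
pose N := maxn (size Q1) (size Q2).
rewrite !(@jcoef_widen N) ?leq_maxl ?leq_maxr ?(leq_trans (size_polyD _ _)) //.
by rewrite -big_split; apply: eq_bigr => k _; rewrite coefD mulrDl.
Qed.

Lemma jcoefZ c Q i : jcoef (c *: Q) i = c * jcoef Q i.
Proof.
rewrite !(@jcoef_widen (size Q)) ?size_scale_leq // mulr_sumr.
by apply: eq_bigr => k _; rewrite coefZ mulrA.
Qed.

Lemma jcoefXn k : jcoef 'X^k =1 jcoefX k.
Proof.
move=> i; rewrite (@jcoef_widen k.+1) ?size_polyXn //.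
rewrite big_ord_recr /= big1 ?add0r ?coefXn ?eqxx ?mul1r // => m _.
by rewrite coefXn ltn_eqF ?mul0r.
Qed.

Lemma jcoefMX Q i : jcoef (Q * 'X) i = jcoef Q (i - 1) + jcoef Q (i + 1).
Proof.
rewrite (@jcoef_widen (size Q).+1); last first.
  by rewrite (leq_trans (size_polyMleq _ _)) // size_polyX addn2.
rewrite big_ord_recl coefMX /= mul0r add0r -big_split; apply: eq_bigr => k _.
by rewrite coefMX /= jcoefXS mulrDr.
Qed.

Lemma jcoef_even Q i : jcoef Q (- i) = jcoef Q i.
Proof. by apply: eq_bigr => k _; rewrite jcoefX_even. Qed.

Lemma jcoef_supp N Q : (size Q <= N.+1)%N -> supp (- N%:Z) N%:Z (jcoef Q).
Proof.
move=> hN i hi; apply: big1 => k _; rewrite jcoefX_supp ?mulr0 //.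
by have := ltn_ord k; lia.
Qed.

Lemma jcoef_top N Q : (size Q <= N.+1)%N -> jcoef Q N%:Z = Q`_N.
Proof.
move=> hN; rewrite (jcoef_widen _ hN) big_ord_recr /= jcoefX_top mulr1.
rewrite big1 ?add0r // => k _; rewrite jcoefX_supp ?mulr0 //.
by have := ltn_ord k; lia.
Qed.

(** By parity the term of degree [N.+1] contributes nothing at $z^N$, so the coefficient just below
    the top can be read off directly. *)
Lemma jcoef_subtop N Q : (size Q <= N.+2)%N -> jcoef Q N%:Z = Q`_N.
Proof.
move=> hN; rewrite (jcoef_widen _ hN) 2!big_ord_recr /= jcoefX_top mulr1.
have -> : jcoefX N.+1 N = 0 by rewrite -(jcoefX_subtop N.+1); congr jcoefX; lia.
rewrite mulr0 addr0 big1 ?add0r // => k _; rewrite jcoefX_supp ?mulr0 //.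
by have := ltn_ord k; lia.
Qed.

(** Subtracting [f N.+1] times $(z+z^{-1})^{N+1}$ removes both extreme coefficients, by evenness. *)
Lemma even_jcoef N f : supp (- N%:Z) N%:Z f -> (forall i : int, f (- i) = f i) ->
  exists2 Q : {poly F}, (size Q <= N.+1)%N & jcoef Q =1 f.
Proof.
elim: N f => [|N IH] f hf f_even.
  exists (f 0)%:P => [|i]; first exact: size_polyC_leq1.
  rewrite (@jcoef_widen 1) ?size_polyC_leq1 // big_ord1 coefC /= jcoefX0.
  by case: eqVneq => [->|h]; rewrite ?mulr1 // mulr0 hf //; lia.
have [||Q hQ eQ] := IH (fun i => f i - f N.+1%:Z * jcoefX N.+1 i).
- move=> i hi; case: (eqVneq i N.+1%:Z) => [->|h1].
    by rewrite jcoefX_top mulr1 subrr.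
  case: (eqVneq i (- N.+1%:Z)) => [->|h2].
    by rewrite jcoefX_even jcoefX_top f_even mulr1 subrr.
  by rewrite hf ?jcoefX_supp ?mulr0 ?subrr //; lia.
- by move=> i; rewrite f_even jcoefX_even.
exists (Q + f N.+1%:Z *: 'X^(N.+1)) => [|i].
  rewrite (leq_trans (size_polyD _ _)) // geq_max (leq_trans hQ) //=.
  by rewrite (leq_trans (size_scale_leq _ _)) // size_polyXn.
by rewrite jcoefD jcoefZ jcoefXn eQ subrK.
Qed.

(** * Iterated neighbour sums: the action of powers of $x$ on moments *)

Definition neighbor_sum e (t : int) : F := e (t - 1) + e (t + 1).

Lemma iter_neighbor_vanish N e : (forall t : int, `|t| < N%:Z -> e t = 0) ->
  forall k t, `|t| < N%:Z - k%:Z -> iter k neighbor_sum e t = 0.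
Proof.
move=> h0; elim=> [|k IH] t ht; first by apply: h0; lia.
by rewrite iterS /neighbor_sum !IH ?addr0 //; lia.
Qed.

(** Each step shrinks the interval of zeros by one at each end; at its border the inner neighbour is
    zero and the outer one passes its value on unchanged. *)
Lemma iter_neighbor_edge N e : (forall t : int, `|t| < N%:Z -> e t = 0) ->
  forall k, (k < N)%N ->
  iter k neighbor_sum e (N%:Z - k%:Z) = e N%:Z /\
  iter k neighbor_sum e (k%:Z - N%:Z) = e (- N%:Z).
Proof.
move=> h0; elim=> [|k IH] hk; first by rewrite subr0 sub0r.
have [h1 h2] := IH (ltnW hk); rewrite !iterS /neighbor_sum; split.
  rewrite (iter_neighbor_vanish h0) ?add0r -?h1; last by lia.
  by congr (iter k neighbor_sum e _); lia.
rewrite (@iter_neighbor_vanish N e h0 k (_ + 1)) ?addr0 -?h2; last by lia.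
by congr (iter k neighbor_sum e _); lia.
Qed.

(** After [N] steps the two border values meet at 0. For [N = 0] the right side would count [e 0]
    twice. *)
Lemma iter_neighbor_center N e : (forall t : int, `|t| < N%:Z -> e t = 0) ->
  (0 < N)%N -> iter N neighbor_sum e 0 = e N%:Z + e (- N%:Z).
Proof.
case: N => // N h0 _; have [h1 h2] := iter_neighbor_edge h0 (ltnSn N).
rewrite iterS /neighbor_sum addrC -h1 -h2; congr (_ + _);
  congr (iter N neighbor_sum e _); lia.
Qed.

(** Once [e] vanishes for $|t|<N$, evenness makes the [N]-th iterate at 0 equal to [2 * e N] (just
    [e 0] if [N = 0]), so the zeros spread outwards one step at a time. *)
Lemma neighbor_center_vanish N e : 2%:R != 0 :> F -> (forall t : int, e (- t) = e t) ->
  (forall k, (k < N)%N -> iter k neighbor_sum e 0 = 0) ->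
  forall t : int, `|t| < N%:Z -> e t = 0.
Proof.
move=> two0 e_even; elim: N => [|N IH] hN t ht; first by lia.
have h0 := IH (fun k hk => hN k (ltnW hk)).
have eN : e N%:Z = 0.
  case: N => [|N] in hN h0 {IH ht} *; first exact: (hN 0%N).
  have := hN N.+1 (ltnSn _); rewrite iter_neighbor_center // e_even -mulr2n -mulr_natr.
  by move=> /eqP; rewrite mulf_eq0 (negbTE two0) orbF => /eqP.
have [ltN|geN] := boolP (`|t| < N%:Z); first exact: h0.
have [->|->] // : t = N%:Z \/ t = - N%:Z by lia.
by rewrite e_even.
Qed.

Lemma ev_jcoefMX K mu Q t : (size Q <= K)%N ->
  ev K mu (jcoef (Q * 'X)) t = neighbor_sum (ev K mu (jcoef Q)) t.
Proof.
move=> hK; have hQ : supp (- K%:Z + 1) (K%:Z - 1) (jcoef Q).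
  case: K hK => [|K] hK; last first.
    by apply: supp_widen (jcoef_supp hK); lia.
  by move=> i _; rewrite /jcoef big1 // => -[k hk]; lia.
rewrite (@ev_eq _ _ _ _ (fun i => jcoef Q (i + - 1) + jcoef Q (i + 1))); last first.
  exact: jcoefMX.
by rewrite evD !ev_shift // => i hi; apply: hQ; lia.
Qed.

Lemma ev_jcoefMXn K mu Q k t : (size Q + k <= K)%N ->
  ev K mu (jcoef (Q * 'X^k)) t = iter k neighbor_sum (ev K mu (jcoef Q)) t.
Proof.
elim: k t => [|k IH] t hK; first by rewrite expr0 mulr1.
rewrite exprSr mulrA ev_jcoefMX; last first.
  by rewrite (leq_trans (size_polyMleq _ _)) // size_polyXn; lia.
by rewrite /= /neighbor_sum !IH //; lia.
Qed.

Variables (r : nat) (Lm : 'I_r -> int -> F).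

Lemma Mapply_jcoef K j Q : (size Q <= K)%N ->
  Mapply Lm j Q = ev K (Lm j) (jcoef Q) 0.
Proof.
move=> hK; rewrite ev_sum; apply: eq_bigr => k _; rewrite evZ; congr (_ * _).
rewrite /Mmom -lapply_ev; last first.
  by apply: supp_widen (@jcoefX_supp k); have := ltn_ord k; lia.
by congr (lapply _ (_, _)); rewrite oppr0 addr0.
Qed.

(* Multiplying by x = w + w^-1 replaces t |-> L[f w^-t] by the sum of its neighbours. *)
Lemma Mapply_Xn K j Q k : (size Q + k <= K)%N ->
  Mapply Lm j (Q * 'X^k) = iter k neighbor_sum (ev K (Lm j) (jcoef Q)) 0.
Proof.
move=> hK; rewrite (@Mapply_jcoef K) ?ev_jcoefMXn //.
by rewrite (leq_trans (size_polyMleq _ _)) // size_polyXn; lia.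
Qed.

Lemma MapplyD j Q1 Q2 : Mapply Lm j (Q1 + Q2) = Mapply Lm j Q1 + Mapply Lm j Q2.
Proof.
pose K := maxn (size Q1) (size Q2).
rewrite !(@Mapply_jcoef K) ?leq_maxl ?leq_maxr ?(leq_trans (size_polyD _ _)) //.
by rewrite -evD; apply: ev_eq => i; rewrite jcoefD.
Qed.

Lemma MapplyZ j c Q : Mapply Lm j (c *: Q) = c * Mapply Lm j Q.
Proof.
rewrite !(@Mapply_jcoef (size Q)) ?size_scale_leq // -evZ.
by apply: ev_eq => i; rewrite jcoefZ.
Qed.

Lemma Mapply0 j : Mapply Lm j 0 = 0.
Proof. by rewrite -[X in Mapply _ _ X](scale0r 0) MapplyZ mul0r. Qed.

Lemma Mapply_sum j (I : finType) (Q : I -> {poly F}) :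
  Mapply Lm j (\sum_l Q l) = \sum_l Mapply Lm j (Q l).
Proof. exact: (big_morph _ (MapplyD j) (Mapply0 j)). Qed.

End Joukowski.

(** * Relations between neighbouring $\Phi$ *)

Section SzegoRelations.
Set Implicit Arguments.
Unset Strict Implicit.

Variables (F : fieldType) (r : nat) (Lm : 'I_r -> int -> F).
Implicit Types (n m : mind r) (f : int -> F) (K : nat) (i j l : 'I_r) (k t s : int).

Hypothesis Lsym : forall j k, Lm j (- k) = Lm j k.
Hypothesis normal_diag : forall n, mnat n -> normal Lm n n.
Hypothesis normal_up : forall n j, mnat n -> normal Lm (n + unitv j) n.
Variable Phi : mind r -> mind r -> lpoly F.
Hypothesis HPhi : forall n m, normal Lm n m -> IsPhi Lm n m (Phi n m).

Local Notation phi n m := (lpcoef (Phi n m)).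
Local Notation "n +_ j" := (n + unitv j) (at level 50, j at level 9).
Local Notation "n -_ j" := (n - unitv j) (at level 50, j at level 9).

Lemma msum_up n j : msum (n +_ j) = msum n + 1.
Proof. by rewrite msumD msum_unitv. Qed.

Lemma msum_down n j : msum (n -_ j) = msum n - 1.
Proof. by rewrite msumD msumN msum_unitv. Qed.

Lemma mind_up n j i : (n +_ j) i = n i + (i == j)%:R.
Proof. by rewrite mindD unitvE. Qed.

Lemma mind_down n j i : (n -_ j) i = n i - (i == j)%:R.
Proof. by rewrite mindD mindN unitvE. Qed.

Lemma normal_left_up n j : mnat n -> normal Lm n (n +_ j).
Proof. by move=> hn; apply: normal_swap => //; apply: normal_up. Qed.

Lemma normal_left_down n j : mnat n -> 1 <= n j -> normal Lm (n -_ j) n.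
Proof.
by move=> hn hj; have := normal_left_up j (mnat_subu hn hj); rewrite subrK.
Qed.

(** This covers [n = - m] too: nonnegative indices are then both zero, $\Phi = 1$ and the
    orthogonality range is empty. *)
Lemma Phi_spec n m : mnat n -> mnat m -> normal Lm n m ->
  [/\ supp (- msum m) (msum n) (phi n m), phi n m (msum n) = 1
    & forall K, msum n <= K%:Z -> msum m <= K%:Z -> orth Lm K n m (phi n m)].
Proof.
move=> hn hm /HPhi; rewrite /IsPhi; case: eqP => [nm h|_ [h1 [h2 h3]]].
  have n0 : msum n = 0.
    by have := msum_ge0 hn; have := msum_ge0 hm; rewrite nm msumN; lia.
  have m0 : msum m = 0 by move: n0; rewrite nm msumN; lia.
  rewrite n0 m0; split=> [k hk||K _ _ j k hk]; rewrite ?h ?eqxx //.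
    by rewrite [k == 0]negbTE //; lia.
  by move: hk; rewrite nm mindN; lia.
split=> // K hK1 hK2 j k hk; rewrite -lapply_ev ?h3 //.
by apply: supp_widen h1; lia.
Qed.

Lemma lapply_Phi K n m j k : mnat n -> mnat m -> normal Lm n m ->
  msum n <= K%:Z -> msum m <= K%:Z ->
  lapply (Lm j) (Defs.lshift (Phi n m) (- k)) = ev K (Lm j) (phi n m) k.
Proof.
move=> hn hm nm h1 h2; have [hs _ _] := Phi_spec hn hm nm.
by apply: lapply_ev; apply: supp_widen hs; lia.
Qed.

Lemma Phi_edge_neq0 K n m j : mnat n -> mnat m -> normal Lm n m ->
  normal Lm (n +_ j) m -> msum n <= K%:Z -> msum m <= K%:Z ->
  ev K (Lm j) (phi n m) (n j) != 0.
Proof.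
move=> hn hm nm nm1 h1 h2; have [hs h_1 ho] := Phi_spec hn hm nm.
apply/eqP => h0; have := oner_neq0 F; rewrite -h_1.
rewrite (normal_uniq (K := K) nm1) ?eqxx ?msum_up //; first by lia.
  by rewrite addrK.
move=> i k; rewrite mind_up => hk.
case: (eqVneq k (n i)) => [ek|nk]; last by apply: ho => //; case: eqP hk; lia.
by rewrite ek; case: eqP hk => [-> //|_]; lia.
Qed.

(* X_j = A + alpha_{n;n+e_j} z^-1 A*, coefficientwise. *)
Lemma left_up_decomp n j s : mnat n ->
  phi n (n +_ j) s =
    phi n n s + alpha Phi n (n +_ j) * phi n n (- (s + 1)).
Proof.
move=> hn; have N0 := msum_ge0 hn.
have [K hK] : exists K : nat, msum n + 3 <= K%:Z.
  by exists (absz (msum n + 3)); lia.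
have hn1 := mnat_addu j hn.
have [sA A1 oA] := Phi_spec hn hn (normal_diag hn).
have [sX X1 oX] := Phi_spec hn hn1 (normal_left_up j hn).
rewrite msum_up in sX oX.
set xi := alpha _ _ _; have xiE : phi n (n +_ j) (- (msum n + 1)) = xi.
  by rewrite /xi /alpha msum_up.
pose f s := phi n (n +_ j) s - (phi n n s + xi * phi n n (- (s + 1))).
suff /(_ s) /subr0_eq : f =1 (fun=> 0) by [].
apply: (normal_uniq (K := K) (normal_diag hn)); try lia.
  (* The end coefficients cancel: at $|n|$ because both leading coefficients are 1, at $-(|n|+1)$ by
     the choice of [xi]. *)
  move=> t ht; rewrite /f.
  have [->|t1] := eqVneq t (msum n).
    by rewrite X1 A1 sA ?mulr0 ?addr0 ?subrr //; lia.
  have [->|t2] := eqVneq t (- (msum n + 1)).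
    have -> : - (- (msum n + 1) + 1) = msum n by lia.
    by rewrite xiE A1 sA ?mulr1 ?add0r ?subrr //; lia.
  by rewrite sX ?sA ?(sA (- (t + 1))) ?mulr0 ?addr0 ?subr0 //; lia.
move=> i k hk; rewrite evB evD evZ ev_revS //; last first.
  by apply: supp_widen sA; lia.
rewrite oX ?oA ?mulr0 ?addr0 ?subr0 //; try lia.
by rewrite mind_up; case: eqP; lia.
Qed.

(** Pair the decomposition of $X_j$ with exponents $n_j$ and $-(n_j+1)$. The latter pairing vanishes
    for $X_j$, which expresses $L_j[A w^{n_j+1}]$ as $-\alpha L_j[A w^{-n_j}]$. *)
Lemma left_up_edge K n j : mnat n -> msum n + 2 <= K%:Z ->
  ev K (Lm j) (phi n (n +_ j)) (n j) =
    (1 - alpha Phi n (n +_ j) ^+ 2) * ev K (Lm j) (phi n n) (n j).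
Proof.
move=> hn hK; have hn1 := mnat_addu j hn; have N0 := msum_ge0 hn.
have nj0 : 0 <= n j by apply/mnatP.
have [sA A1 oA] := Phi_spec hn hn (normal_diag hn).
have [sX X1 oX] := Phi_spec hn hn1 (normal_left_up j hn).
rewrite msum_up in oX; set xi := alpha _ _ _.
have E k : ev K (Lm j) (phi n (n +_ j)) k =
    ev K (Lm j) (phi n n) k + xi * ev K (Lm j) (phi n n) (- (k + 1)).
  rewrite (ev_eq _ _ _ (fun s => left_up_decomp j s hn)) evD evZ ev_revS //.
  by apply: supp_widen sA; lia.
have X0 : ev K (Lm j) (phi n (n +_ j)) (- (n j + 1)) = 0.
  by apply: oX; rewrite ?mind_up ?eqxx; lia.
move: X0; rewrite !E; have -> : - (- (n j + 1) + 1) = n j by lia.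
by move=> /eqP; rewrite addr_eq0 => /eqP ->; ring.
Qed.

(* The z^|n| coefficient of Phi_{n+e_j;n+e_j} = B_j + alpha z^-1 X_j*. *)
Lemma diag_up_subtop n j : mnat n ->
  phi (n +_ j) (n +_ j) (msum n) =
    phi (n +_ j) n (msum n) + alpha Phi (n +_ j) (n +_ j) * alpha Phi n (n +_ j).
Proof.
move=> hn; have N0 := msum_ge0 hn.
have [K hK] : exists K : nat, msum n + 3 <= K%:Z.
  by exists (absz (msum n + 3)); lia.
have hn1 := mnat_addu j hn.
have [sX X1 oX] := Phi_spec hn hn1 (normal_left_up j hn).
have [sB B1 oB] := Phi_spec hn1 hn (normal_up j hn).
have [sA A1 oA] := Phi_spec hn1 hn1 (normal_diag hn1).
rewrite !msum_up in sX sB sA B1 A1 oX oB oA.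
set al := alpha _ _ (n +_ j).
have alE : phi (n +_ j) (n +_ j) (- (msum n + 1)) = al.
  by rewrite /al /alpha msum_up.
pose f s := phi (n +_ j) (n +_ j) s -
  (phi (n +_ j) n s + al * phi n (n +_ j) (- (s + 1))).
suff /(_ (msum n)) /subr0_eq : f =1 (fun=> 0) by rewrite /alpha msum_up.
apply: (normal_uniq (K := K) (normal_up j hn)); rewrite ?msum_up; try lia.
  move=> t ht; rewrite /f.
  have [->|t1] := eqVneq t (msum n + 1).
    by rewrite B1 A1 sX ?mulr0 ?addr0 ?subrr //; lia.
  have [->|t2] := eqVneq t (- (msum n + 1)).
    have -> : - (- (msum n + 1) + 1) = msum n by lia.
    by rewrite alE X1 sB ?mulr1 ?add0r ?subrr //; lia.
  by rewrite sX ?sA ?sB ?mulr0 ?addr0 ?subr0 //; lia.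
move=> i k hk; rewrite evB evD evZ ev_revS //; last first.
  by apply: supp_widen sX; lia.
by rewrite oX ?oA ?oB ?mulr0 ?addr0 ?subr0 //; try lia; move: hk; rewrite ?mind_up; case: eqP; lia.
Qed.

(* B_l - B_j = gamma^{lj} A, paired with w^{-n_l} under L_l, where B_l vanishes. *)
Lemma gamma_spec K n l j : mnat n -> msum n + 1 <= K%:Z -> l != j ->
  ev K (Lm l) (phi (n +_ j) n) (n l) =
    - (gamma Lm Phi n n l j * ev K (Lm l) (phi n n) (n l)).
Proof.
move=> hn hK lj; have N0 := msum_ge0 hn.
have [hl hj] := (mnat_addu l hn, mnat_addu j hn).
have [sA A1 oA] := Phi_spec hn hn (normal_diag hn).
have [sB B1 oB] := Phi_spec hl hn (normal_up l hn).
have [sD D1 oD] := Phi_spec hj hn (normal_up j hn).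
rewrite !msum_up in sB sD B1 D1 oB oD.
pose f s := phi (n +_ l) n s - (phi (n +_ j) n s + gamma Lm Phi n n l j * phi n n s).
have evf i k : ev K (Lm i) f k = ev K (Lm i) (phi (n +_ l) n) k -
    (ev K (Lm i) (phi (n +_ j) n) k +
     gamma Lm Phi n n l j * ev K (Lm i) (phi n n) k).
  by rewrite evB evD evZ.
have f0 : f =1 (fun=> 0).
  apply: (normal_uniq (K := K) (normal_up j hn)); rewrite ?msum_up; try lia.
    move=> t ht; rewrite /f.
    have [->|t1] := eqVneq t (msum n + 1).
      by rewrite B1 D1 sA ?mulr0 ?addr0 ?subrr //; lia.
    by rewrite sB ?sA ?sD ?mulr0 ?addr0 ?subr0 //; lia.
  move=> i k; rewrite mind_up evf => hk; rewrite oD ?mind_up; try lia.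
  (* Only $k = n_j$ under $L_j$ escapes the orthogonality of $A$ and $B_l$; there the definition of
     [gamma] gives the cancellation. *)
  rewrite add0r; case: (eqVneq k (n i)) => [ek|nk]; last first.
    have hk' : - n i <= k <= n i - 1 by case: eqP hk; lia.
    rewrite oB ?oA ?mulr0 ?subr0 //; try lia.
    by rewrite mind_up; case: (i =P l); lia.
  have ij : i = j by apply/eqP; move: hk; rewrite ek; case: eqP => //; lia.
  rewrite ek ij /gamma !(lapply_Phi (K := K)) ?normal_up ?normal_diag ?msum_up //; try lia.
  rewrite divfK ?subrr //.
  by apply: Phi_edge_neq0; rewrite ?normal_up ?normal_diag //; lia.
have := evf l (n l); rewrite ev_eq0 // oB; try lia.
  by rewrite sub0r => /esym/eqP; rewrite oppr_eq0 addr_eq0 => /eqP.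
by rewrite mind_up eqxx; have /mnatP/(_ l) := hn; lia.
Qed.

(** For the second index [n] the cone condition is $2n_l - 1 \ge 0$, which over the integers means
    $n_l \ge 1$. *)
Lemma rho_neq0E K n l : mnat n -> msum n + 1 <= K%:Z -> 1 <= n l ->
  rho Lm Phi n n l =
    ev K (Lm l) (phi n n) (n l) / ev K (Lm l) (phi (n -_ l) n) (n l - 1).
Proof.
move=> hn hK hl; rewrite /rho ifT; last first.
  by apply/forallP => i; have /mnatP/(_ i) := hn; rewrite mind_down; case: eqP => [->|_]; lia.
have -> : - n l + 1 = - (n l - 1) by lia.
have hm := mnat_subu hn hl.
by rewrite !(lapply_Phi (K := K)) ?normal_left_down ?normal_diag ?msum_down //; lia.
Qed.

Lemma rho_eq0 n l : mnat n -> ~~ (1 <= n l) -> rho Lm Phi n n l = 0.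
Proof.
move=> hn hl; rewrite /rho ifF //; apply/negbTE/negP => /forallP/(_ l).
by rewrite mind_down eqxx; have /mnatP/(_ l) := hn; lia.
Qed.

Lemma left_down_edge_neq0 K n l : mnat n -> msum n <= K%:Z -> 1 <= n l ->
  ev K (Lm l) (phi (n -_ l) n) (n l - 1) != 0.
Proof.
move=> hn hK hl; have hm := mnat_subu hn hl; have N0 := msum_ge0 hn.
have -> : n l - 1 = (n -_ l) l by rewrite mind_down eqxx.
apply: Phi_edge_neq0; rewrite ?normal_left_down ?subrK ?normal_diag ?msum_down //; lia.
Qed.

(* The z^|n| coefficient of z A = B_j - beta_j A* + sum_l rho_l gamma^{lj} z C_l. *)
Lemma up_subtop n j : mnat n ->
  phi (n +_ j) n (msum n) =
    phi n n (msum n - 1) + alpha Phi (n +_ j) n * alpha Phi n n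
    - \sum_(l < r | l != j) rho Lm Phi n n l * gamma Lm Phi n n l j.
Proof.
move=> hn; have N0 := msum_ge0 hn.
have [K hK] : exists K : nat, msum n + 3 <= K%:Z.
  by exists (absz (msum n + 3)); lia.
have hj := mnat_addu j hn.
have [sA A1 oA] := Phi_spec hn hn (normal_diag hn).
have [sB B1 oB] := Phi_spec hj hn (normal_up j hn).
rewrite !msum_up in sB B1 oB.
set be := alpha Phi (n +_ j) n; set al := alpha Phi n n.
(* When [n l = 0] this coefficient is 0, so no information on [Phi (n - unitv l) n] is required. *)
pose c l := rho Lm Phi n n l * gamma Lm Phi n n l j.
pose g s := \sum_(l < r | l != j) c l * phi (n -_ l) n s.
have sg : supp (- msum n) (msum n - 1) g.
  move=> s hs; apply: big1 => l _; have [hl|hl] := boolP (1 <= n l); last first.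
    by rewrite /c rho_eq0 // !mul0r.
  have [sC _ _] := Phi_spec (mnat_subu hn hl) hn (normal_left_down hn hl).
  by rewrite sC ?mulr0 // msum_down.
have g_top : g (msum n - 1) = \sum_(l < r | l != j) c l.
  apply: eq_bigr => l _; have [hl|hl] := boolP (1 <= n l); last first.
    by rewrite /c rho_eq0 // !mul0r.
  have [_ C1 _] := Phi_spec (mnat_subu hn hl) hn (normal_left_down hn hl).
  by rewrite -(msum_down n l) C1 mulr1.
(* The identity is divided by $z$, so that after cancellation at both ends the difference has the
   support needed for normality of $(n;n)$. *)
pose f s := phi n n s + be * phi n n (- (s + 1)) - (phi (n +_ j) n (s + 1) + g s).
suff /(_ (msum n - 1)) : f =1 (fun=> 0).
  rewrite /f g_top subrK => /subr0_eq E.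
  by apply/eqP; rewrite eq_sym subr_eq -E.
apply: (normal_uniq (K := K) (normal_diag hn)); try lia.
  move=> t ht; rewrite /f.
  have [->|t1] := eqVneq t (msum n).
    by rewrite B1 A1 sg ?sA ?mulr0 ?addr0 ?subrr //; lia.
  have [->|t2] := eqVneq t (- (msum n + 1)).
    have -> : - (- (msum n + 1) + 1) = msum n by lia.
    have -> : - (msum n + 1) + 1 = - msum n by lia.
    by rewrite A1 sg ?sA ?mulr1 ?addr0 ?add0r ?subrr //; lia.
  by rewrite sg ?sA ?(sA (- (t + 1))) ?sB ?mulr0 ?addr0 ?subr0 //; lia.
have nonneg i : 0 <= n i by apply/mnatP.
move=> i k hk; rewrite evB !evD evZ ev_revS //; last first.
  by apply: supp_widen sA; lia.
rewrite (@ev_shift _ _ _ (phi (n +_ j) n)); first last.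
- by move=> s hs; apply: sB; lia.
- by apply: supp_widen sB; lia.
rewrite !oA ?mulr0 ?addr0 ?add0r; try lia; apply/eqP; rewrite oppr_eq0; apply/eqP.
have hi : 1 <= n i by lia.
rewrite /g ev_sum.
have oC l : 1 <= n l -> (i != l) || (k != n i - 1) ->
    ev K (Lm i) (phi (n -_ l) n) k = 0.
  move=> hl il; have hm := mnat_subu hn hl.
  have [_ _ oC] := Phi_spec hm hn (normal_left_down hn hl).
  apply: oC; rewrite ?msum_down ?mind_down; try lia.
have sum_oC (Pr : pred 'I_r) : (forall l, Pr l -> (i != l) || (k != n i - 1)) ->
    \sum_(l | Pr l) ev K (Lm i) (fun s => c l * phi (n -_ l) n s) k = 0.
  move=> hP; apply: big1 => l /hP Pl; rewrite evZ.
  have [hl|hl] := boolP (1 <= n l); first by rewrite oC ?mulr0.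
  by rewrite /c rho_eq0 // !mul0r.
have [ek|nk] := eqVneq k (n i - 1); last first.
  rewrite sum_oC ?addr0 => [|l _]; last by rewrite nk orbT.
  by rewrite oB //; try lia; rewrite mind_up; case: eqP; lia.
(* The shift moves $k = n_i-1$ to $n_i$. For $i=j$, $B_j$ is still orthogonal there; otherwise only
   $l=i$ survives in the sum, and [rho] and [gamma_spec] make it cancel the edge value of $B_j$. *)
have [ij|ij] := eqVneq i j.
  rewrite sum_oC ?addr0 => [|l]; last by rewrite ij eq_sym => ->.
  by rewrite oB //; try lia; rewrite mind_up ij eqxx; move: ek hi; rewrite ij; lia.
rewrite (bigD1 i) //= sum_oC ?addr0 => [|l /andP[_ li]]; last by rewrite eq_sym li.
rewrite ek subrK (gamma_spec (K := K)) //; last by lia.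
rewrite evZ /c (rho_neq0E (K := K)) //; last by lia.
have C0 : ev K (Lm i) (phi (n -_ i) n) (n i - 1) != 0.
  by apply: left_down_edge_neq0 => //; lia.
by field.
Qed.

(** * Comparison with the polynomials $P_n$ *)

Hypothesis two_neq0 : 2%:R != 0 :> F.
Variable P : mind r -> {poly F}.
Hypothesis HP : forall n, mnat n -> IsP Lm n (P n).

Definition Morth n (Q : {poly F}) :=
  forall j (k : nat), k%:Z < n j -> Mapply Lm j (Q * 'X^k) = 0.

(** Moments against $x^k$ are iterated neighbour sums at 0 of an even function of [t], so
    [neighbor_center_vanish] inverts the passage. *)
Lemma Morth_ev K n (Q : {poly F}) : mnat n -> (size Q)%:Z + msum n <= K%:Z ->
  Morth n Q <-> forall j t, `|t| < n j -> ev K (Lm j) (jcoef Q) t = 0.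
Proof.
move=> hn hK; split=> [hQ j|hQ j k hk].
  have nj : (absz (n j))%:Z = n j by apply: gez0_abs; apply/mnatP.
  have hj := msum_ge j hn.
  rewrite -nj; apply: neighbor_center_vanish => // [t|k hk].
    by rewrite -ev_rev //; apply: ev_eq => i; rewrite jcoef_even.
  by rewrite -Mapply_Xn ?hQ //; lia.
have hj := msum_ge j hn.
rewrite (@Mapply_Xn _ _ _ K); last by lia.
apply: (@iter_neighbor_vanish _ (absz (n j))); last by lia.
by move=> t ht; apply: hQ; lia.
Qed.

Lemma size_P n : mnat n -> size (P n) = (absz (msum n)).+1.
Proof. by move=> /HP[_ [->]]; rewrite addn1. Qed.

Lemma P_lead n : mnat n -> (P n)`_(absz (msum n)) = 1.
Proof. by move=> hn; have [/monicP <- _] := HP hn; rewrite /lead_coef size_P. Qed.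

Lemma Morth_P n : mnat n -> Morth n (P n).
Proof. by move=> /HP[_ [_]]. Qed.

(** Perfectness of $M$ at [n], in the form of injectivity. *)
Definition unisolvent n :=
  forall Q : {poly F}, (size Q <= absz (msum n))%N -> Morth n Q -> Q = 0.

Lemma MorthD n (Q1 Q2 : {poly F}) : Morth n Q1 -> Morth n Q2 -> Morth n (Q1 + Q2).
Proof. by move=> h1 h2 j k hk; rewrite mulrDl MapplyD h1 ?h2 ?addr0. Qed.

Lemma MorthZ n c (Q : {poly F}) : Morth n Q -> Morth n (c *: Q).
Proof. by move=> h j k hk; rewrite -scalerAl MapplyZ h ?mulr0. Qed.

Lemma unisolvent_P n (Q : {poly F}) : mnat n -> unisolvent n ->
  (size Q <= (absz (msum n)).+1)%N -> Morth n Q -> Q = Q`_(absz (msum n)) *: P n.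
Proof.
move=> hn hU hQ oQ; apply/eqP; rewrite -subr_eq0 -scaleNr; apply/eqP/hU.
  apply/leq_sizeP => k hk; rewrite coefD coefZ.
  have [->|nk] := eqVneq k (absz (msum n)); first by rewrite P_lead // mulr1 subrr.
  have lk : (absz (msum n) < k)%N by rewrite ltn_neqAle eq_sym nk.
  have /leq_sizeP/(_ k (leqnn k)) -> : (size Q <= k)%N by apply: leq_trans lk.
  have /leq_sizeP/(_ k (leqnn k)) -> : (size (P n) <= k)%N by rewrite size_P.
  by rewrite mulr0 addr0.
by apply: MorthD => //; apply: MorthZ; apply: Morth_P.
Qed.

Lemma even_unisolvent K n f : mnat n -> unisolvent n -> 2 * msum n + 2 <= K%:Z ->
  supp (- msum n) (msum n) f -> (forall s, f (- s) = f s) ->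
  (forall j t, `|t| < n j -> ev K (Lm j) f t = 0) ->
  forall s, f s = f (msum n) * jcoef (P n) s.
Proof.
move=> hn hU hK hf f_even hf0 s; have N0 := msum_ge0 hn.
have nN : (absz (msum n))%:Z = msum n by lia.
rewrite -nN in hf *; have [Q hQ eQ] := even_jcoef hf f_even.
rewrite -eQ -[in RHS]eQ (jcoef_top hQ) -jcoefZ -unisolvent_P //.
apply/(Morth_ev (K := K)) => //; first by lia.
by move=> j t ht; rewrite (ev_eq _ _ _ eQ) hf0.
Qed.

(** $A$ and $A^*$ are both orthogonal exactly where $P_n$ needs it, for $|t|<n_j$; the factor is the
    $z^{|n|}$-coefficient of $A+A^*$. *)
Lemma diag_add_rev n s : mnat n -> unisolvent n ->
  phi n n s + phi n n (- s) = (1 + alpha Phi n n) * jcoef (P n) s.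
Proof.
move=> hn hU; have N0 := msum_ge0 hn.
have [K hK] : exists K : nat, 2 * msum n + 3 <= K%:Z.
  by exists (absz (2 * msum n + 3)); lia.
have [sA A1 oA] := Phi_spec hn hn (normal_diag hn).
rewrite /alpha -A1.
apply: (even_unisolvent (K := K) (f := fun s => phi n n s + phi n n (- s))) => //.
- by lia.
- by move=> t ht; rewrite !sA ?addr0 //; lia.
- by move=> t; rewrite opprK addrC.
by move=> j t ht; rewrite evD ev_rev // !oA ?addr0 //; lia.
Qed.

(** The factor is 1 here because $B_j^*$ has no term in $z^{|n|+1}$. *)
Lemma up_add_rev n j s : mnat n -> unisolvent (n +_ j) ->
  phi (n +_ j) n s + phi (n +_ j) n (- s) = jcoef (P (n +_ j)) s.
Proof.
move=> hn hU; have N0 := msum_ge0 hn.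
have [K hK] : exists K : nat, 2 * msum n + 5 <= K%:Z.
  by exists (absz (2 * msum n + 5)); lia.
have hj := mnat_addu j hn.
have [sB B1 oB] := Phi_spec hj hn (normal_up j hn).
pose f s := phi (n +_ j) n s + phi (n +_ j) n (- s).
have f1 : f (msum (n +_ j)) = 1.
  by rewrite /f B1 sB ?addr0 // msum_up; lia.
rewrite -[RHS]mul1r -f1; apply: (even_unisolvent (K := K)) => //.
- by rewrite msum_up; lia.
- by rewrite !msum_up in sB * => t ht; rewrite /f !sB ?addr0 //; lia.
- by move=> t; rewrite /f opprK addrC.
move=> i t ht; rewrite msum_up in oB; rewrite evD ev_rev //.
by rewrite !oB ?addr0 //; try lia; move: ht; rewrite mind_up; case: eqP; lia.
Qed.

(** The moment collects the values at $\pm n_j$; after scaling by $1+\alpha$ each equals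
    $L_j[A w^{-n_j}]$, since $A$ is orthogonal at $-n_j$. For $n_j = 0$ the factor 2 comes from $A +
    A^*$ itself. *)
Lemma Mapply_P_edge K n j : mnat n -> unisolvent n -> 2 * msum n + 3 <= K%:Z ->
  (1 + alpha Phi n n) * Mapply Lm j (P n * 'X^(absz (n j))) =
    2%:R * ev K (Lm j) (phi n n) (n j).
Proof.
move=> hn hU hK; have N0 := msum_ge0 hn; have hj := msum_ge j hn.
have nj0 : 0 <= n j by apply/mnatP.
have [sA A1 oA] := Phi_spec hn hn (normal_diag hn).
have evP t : (1 + alpha Phi n n) * ev K (Lm j) (jcoef (P n)) t =
    ev K (Lm j) (phi n n) t + ev K (Lm j) (phi n n) (- t).
  by rewrite -evZ -ev_rev // -evD; apply: ev_eq => s; rewrite diag_add_rev.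
have sP := size_P hn; rewrite (@Mapply_Xn _ _ _ K); last by lia.
have [nj|nj] := eqVneq (n j) 0.
  by rewrite nj /= evP oppr0; ring.
rewrite iter_neighbor_center; last by lia.
  have -> : (absz (n j))%:Z = n j by lia.
  rewrite mulrDr !evP opprK (oA _ _ _ j (- n j)); try lia.
  by ring.
have /(Morth_ev (K := K) hn) h := Morth_P hn.
by move=> t ht; apply: h; lia.
Qed.

(* Induction on |n|: with p = n - e_j, Q must be a multiple c P_p, and the extra
   condition M_j[Q x^{p_j}] = 0 forces c = 0 because the edge value
   L_j[Phi_{p;p} w^{-p_j}] is nonzero. *)
Lemma unisolventP n : mnat n -> unisolvent n.
Proof.
move: {2}(absz (msum n)) (erefl (absz (msum n))) => N.
elim: N n => [|N IH] n eN hn Q; rewrite eN => hQ oQ.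
  by apply/eqP; rewrite -size_poly_leq0.
have [j hj] : exists j, 1 <= n j.
  apply/existsP; apply: contraPT eN => /existsPn h.
  rewrite /msum big1 // => i _; have /mnatP/(_ i) := hn; have := h i; lia.
have hp := mnat_subu hn hj; pose p := n -_ j.
have N0 := msum_ge0 hn; have ep : absz (msum p) = N by rewrite /p msum_down; lia.
have hU := IH p ep hp.
have pj : (absz (p j))%:Z = n j - 1 by rewrite /p mind_down eqxx; lia.
have QE : Q = Q`_N *: P p.
  rewrite -ep; apply: unisolvent_P => //; rewrite ?ep // => i k hk; apply: oQ.
  by move: hk; rewrite /p mind_down; case: eqP; lia.
have [K hK] : exists K : nat, 2 * msum n + 3 <= K%:Z.
  by exists (absz (2 * msum n + 3)); lia.
have hKp : 2 * msum p + 3 <= K%:Z by rewrite /p msum_down; lia.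
have A0 : ev K (Lm j) (phi p p) (p j) != 0.
  by apply: Phi_edge_neq0; rewrite ?normal_up ?normal_diag //; lia.
have : Mapply Lm j (Q * 'X^(absz (p j))) = 0 by apply: oQ; lia.
rewrite {1}QE -scalerAl MapplyZ => /(congr1 ( *%R (1 + alpha Phi p p))).
rewrite mulrCA (Mapply_P_edge (K := K)) // mulr0 => /eqP.
rewrite !mulf_eq0 (negbTE two_neq0) (negbTE A0) !orbF => /eqP Q0.
by rewrite QE Q0 scale0r.
Qed.

(** * The recurrence coefficients *)

Variables a b : mind r -> 'I_r -> F.
Hypothesis Hrec : forall n, mnat n -> forall j,
  'X * P n = P (n +_ j) + b n j *: P n +
    \sum_(l < r) a n l *: (if 0 < n l then P (n -_ l) else 0).

(** Applying $M_j$ to the recurrence times $x^{n_j-1}$ kills every term but that of $a_{n,j}$. Edge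
    values replace the moments, and [left_up_edge] produces the denominator of [rho]. *)
Lemma nearest_neighbor_a n j : mnat n -> 1 <= n j ->
  a n j = (1 + alpha Phi (n -_ j) (n -_ j)) * (1 - alpha Phi (n -_ j) n ^+ 2)
            * rho Lm Phi n n j / (1 + alpha Phi n n).
Proof.
move=> hn hj; have N0 := msum_ge0 hn.
have [K hK] : exists K : nat, 2 * msum n + 3 <= K%:Z.
  by exists (absz (2 * msum n + 3)); lia.
set p := n -_ j; have hp : mnat p := mnat_subu hn hj.
have pn : p +_ j = n by rewrite /p subrK.
have mp : msum p = msum n - 1 by rewrite /p msum_down.
have pj : p j = n j - 1 by rewrite /p mind_down eqxx.
have edge_n := Mapply_P_edge j hn (unisolventP hn) hK.
have edge_p := Mapply_P_edge j hp (unisolventP hp) (ltac:(lia) : 2 * msum p + 3 <= K%:Z).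
have A0 : ev K (Lm j) (phi n n) (n j) != 0.
  by apply: Phi_edge_neq0; rewrite ?normal_up ?normal_diag //; lia.
have A0p : ev K (Lm j) (phi p p) (p j) != 0.
  by apply: Phi_edge_neq0; rewrite ?normal_up ?normal_diag //; lia.
have X0 := left_down_edge_neq0 (K := K) hn ltac:(lia) hj.
have X_edge := left_up_edge j hp (ltac:(lia) : msum p + 2 <= K%:Z).
rewrite -/p -pj in X0; rewrite pn in X_edge.
rewrite (rho_neq0E (K := K)) //; last by lia.
rewrite -/p -pj.
have arec : Mapply Lm j (P n * 'X^(absz (n j))) =
    a n j * Mapply Lm j (P p * 'X^(absz (p j))).
  have -> : absz (n j) = (absz (p j)).+1 by lia.
  rewrite exprS mulrA [P n * 'X]mulrC (Hrec hn j) !mulrDl -scalerAl mulr_suml.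
  rewrite !MapplyD MapplyZ Mapply_sum.
  rewrite (Morth_P (mnat_addu j hn)); last by rewrite mind_up eqxx; lia.
  rewrite (Morth_P hn) ?mulr0 ?add0r; last by lia.
  rewrite (bigD1 j) //= ifT; last by lia.
  rewrite -scalerAl MapplyZ big1 ?addr0 // => l lj.
  rewrite -scalerAl MapplyZ; case: ifP => hl; last by rewrite mul0r Mapply0 mulr0.
  have hl' : 1 <= n l by lia.
  rewrite (Morth_P (mnat_subu hn hl')) ?mulr0 //.
  have -> : (n -_ l) j = n j; last by rewrite pj; lia.
  by rewrite mind_down eq_sym (negbTE lj) subr0.
have key : a n j * ((1 + alpha Phi n n) * ev K (Lm j) (phi p p) (p j)) =
    (1 + alpha Phi p p) * ev K (Lm j) (phi n n) (n j).
  apply: (mulfI two_neq0).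
  rewrite mulrCA [2%:R * (_ * _)]mulrCA -edge_p [RHS]mulrCA -edge_n arec.
  by ring.
(* A zero factor would make twice the nonzero edge value of $A$ vanish by [edge_n]; likewise
   [q_neq0] rests on the nonzero edge value in [X0]. *)
have al_neq0 : 1 + alpha Phi n n != 0.
  apply: contraNneq A0 => al0; move: edge_n; rewrite al0 mul0r => /esym/eqP.
  by rewrite mulf_eq0 (negbTE two_neq0).
have q_neq0 : 1 - alpha Phi p n ^+ 2 != 0.
  by apply: contraNneq X0 => q0; rewrite X_edge q0 mul0r.
rewrite X_edge -[LHS](mulfK (mulf_neq0 al_neq0 A0p)) key.
by field; rewrite A0p al_neq0.
Qed.

(** Compare coefficients of $x^{|n|}$ in the recurrence: the $P_{n-e_l}$ have too low a degree,
    leaving the second coefficients of $P_n$ and $P_{n+e_j}$. *)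
Lemma nearest_neighbor_b n j : mnat n -> 1 <= n j ->
  b n j = \sum_(l < r | l != j) rho Lm Phi n n l * gamma Lm Phi n n l j
            + alpha Phi n (n -_ j) - alpha Phi (n +_ j) n
            - alpha Phi n n * alpha Phi (n -_ j) n
            - alpha Phi n n * alpha Phi (n +_ j) n.
Proof.
move=> hn hj; have N0 := msum_ge0 hn; have hj' := msum_ge j hn.
set p := n -_ j; have hp : mnat p := mnat_subu hn hj.
have pn : p +_ j = n by rewrite /p subrK.
have mp : msum p = msum n - 1 by rewrite /p msum_down.
have hu := mnat_addu j hn; have mu := msum_up n j.
have [N eN] : exists N : nat, msum n = N.+1%:Z by exists (absz (msum n)).-1; lia.
have eNn : absz (msum n) = N.+1 by lia.
have eNp : msum p = N%:Z by lia.
have recN := congr1 (fun Q : {poly F} => Q`_N.+1) (Hrec hn j).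
rewrite /= coefXM /= !coefD coefZ coef_sum in recN.
rewrite -{2}eNn P_lead // mulr1 big1 ?addr0 in recN; last first.
  move=> l _; rewrite coefZ; case: ifP => hl; rewrite ?coef0 ?mulr0 //.
  have hm : mnat (n -_ l) by apply: mnat_subu => //; lia.
  by rewrite nth_default ?mulr0 // size_P // msum_down; lia.
rewrite -!jcoef_subtop ?size_P ?mu ?eNn // in recN; last by lia.
have hunis : unisolvent (p +_ j) by rewrite pn; apply: unisolventP.
have e1 := up_add_rev N%:Z hp hunis.
have e2 := up_add_rev N.+1%:Z hn (unisolventP hu).
rewrite pn in e1.
rewrite -e1 -e2 in recN.
have e3 := up_subtop j hn.
have e4 := diag_up_subtop j hp.
rewrite pn eNp in e4.
have a1 : phi n p (- N%:Z) = alpha Phi n p by rewrite /alpha eNp.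
have a2 : phi (n +_ j) n (- N.+1%:Z) = alpha Phi (n +_ j) n by rewrite /alpha eN.
have eN1 : msum n - 1 = N by lia.
rewrite eN1 eN e4 in e3; rewrite a1 a2 e3 in recN.
(* A trivial difference, arranged so that [recN] can replace its second copy and the unknown
   [phi n p N] cancels. *)
have -> : b n j = phi n p N + alpha Phi n p - (phi n p N + alpha Phi n p - b n j).
  by ring.
by rewrite {2}recN; ring.
Qed.

End SzegoRelations.

Theorem theorem10p3 (R : realType) (r : nat) (hr : (0 < r)%N)
  (Lm : 'I_r -> int -> R[i])
  (Lsym : forall (j : 'I_r) (k : nat), Lm j k%:Z = Lm j (- k%:Z))
  (Hnorm : forall n : mind r, mnat n ->
     normal Lm n n /\ forall j, normal Lm (n + unitv j) n)
  (Phi : mind r -> mind r -> lpoly R[i])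
  (HPhi : forall n m, normal Lm n m -> IsPhi Lm n m (Phi n m))
  (P : mind r -> {poly R[i]})
  (HP : forall n, mnat n -> IsP Lm n (P n))
  (a b : mind r -> 'I_r -> R[i])
  (Hrec : forall n, mnat n -> forall k : 'I_r,
     'X * P n = P (n + unitv k) + b n k *: P n +
       \sum_(j < r) a n j *: (if 0 < n j then P (n - unitv j) else 0)) :
  forall (n : mind r) (j : 'I_r), mnat n -> 1 <= n j ->
    a n j = (1 + alpha Phi (n - unitv j) (n - unitv j))
              * (1 - alpha Phi (n - unitv j) n ^+ 2)
              * rho Lm Phi n n j / (1 + alpha Phi n n)
    /\
    b n j = \sum_(l < r | l != j) rho Lm Phi n n l * gamma Lm Phi n n l j
            + alpha Phi n (n - unitv j) - alpha Phi (n + unitv j) n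
            - alpha Phi n n * alpha Phi (n - unitv j) n
            - alpha Phi n n * alpha Phi (n + unitv j) n.
Proof.
have Lsym' (j : 'I_r) (k : int) : Lm j (- k) = Lm j k.
  by case: k => k; rewrite ?NegzE ?opprK -Lsym.
have normal_diag n : mnat n -> normal Lm n n by case/Hnorm.
have normal_up n j : mnat n -> normal Lm (n + unitv j) n by case/Hnorm.
have two_neq0 : 2%:R != 0 :> R[i] by rewrite pnatr_eq0.
move=> n j hn hj; split.
  exact: (nearest_neighbor_a Lsym' normal_diag normal_up HPhi two_neq0 HP Hrec).
exact: (nearest_neighbor_b Lsym' normal_diag normal_up HPhi two_neq0 HP Hrec).
Qed.
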